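(* Let $\mathbb K$ be a field, taken as coefficients, let $X$ be a topological space, let $\mathcal U$ be an open covering of $X$ and let $q\ge 0$. If $\gamma\in H_q^{\mathcal U}(X)$ satisfies $\int_\gamma z=0$ for every $z\in H^q_{\mathcal U}(X)$, then $\gamma=0$ in $H_q^{\mathcal U}(X)$.
   Context: Coefficients are in $\mathbb K$. A formal $q$-simplex is an ordered tuple $\sigma=(x_0\ \ldots\ x_q)$ of points of $X$ (repetitions allowed); it is $\mathcal U$-small if all $x_i$ lie in a common element of $\mathcal U$. $S^{\mathcal U}_q(X)$ is the vector space of finite linear combinations of $\mathcal U$-small formal $q$-simplices, with boundary $\partial(x_0\ \ldots\ x_q)=\sum_{j=0}^q(-1)^j(x_0\ \ldots\ \widehat{x_j}\ \ldots\ x_q)$; $H_q^{\mathcal U}(X)$ is the $q$-th homology of this complex. $C^q(X)$ is the space of all functions $\xi\colon X^{q+1}\to\mathbb K$, with $\delta\xi(x_0,\ldots,x_{q+1})=\sum_{j=0}^{q+1}(-1)^j\xi(x_0,\ldots,\widehat{x_j},\ldots,x_{q+1})$. A cochain is $\mathcal U$-locally zero if it vanishes on all tuples contained in a single member of $\mathcal U$. $H^q_{\mathcal U}(X)$ is the cohomology of the complex $\overline C^*_{\mathcal U}(X)$ of cochains modulo $\mathcal U$-locally zero cochains. For $z\in H^q_{\mathcal U}(X)$ represented by $\xi$ (so $\delta\xi$ is $\mathcal U$-locally zero) and $\gamma\in H_q^{\mathcal U}(X)$ represented by a $\mathcal U$-small cycle $c=\sum k_i\sigma_i$, the integral is $\int_\gamma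 z:=\xi(c):=\sum k_i\xi(\sigma_i)$, where $\xi((x_0\ \ldots\ x_q)):=\xi(x_0,\ldots,x_q)$; it is well defined and bilinear. *)

(* Defs.v *)
From HB Require Import structures.
From mathcomp Require Import all_boot all_order all_algebra generic_quotient.
From mathcomp Require Import ring_quotient freeg.
From mathcomp Require Import all_classical topology.

Set Implicit Arguments.
Unset Strict Implicit.
Unset Printing Implicit Defensive.

Import GRing.Theory.
Local Open Scope classical_set_scope.
Local Open Scope ring_scope.
Local Open Scope quotient_scope.

Section QuotientModule.
Variables (R : nzRingType) (V : lmodType R) (W : submodClosed V).

(* A submodClosed predicate only records closure under 0, + and scaling; closure
   under - is derived here so that the library quotient of zmodTypes applies. *)
Definition submod_pred : {pred V} := fun x => x \in W.

Fact submod_pred_zmod_closed : zmod_closed submod_pred.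
Proof. exact: GRing.submod_closedB (submodClosedP W). Qed.
HB.instance Definition _ :=
  GRing.isZmodClosed.Build V submod_pred submod_pred_zmod_closed.

Definition quotmod := Quotient.quot submod_pred.

HB.instance Definition _ := GRing.Zmodule.on quotmod.
HB.instance Definition _ := ZmodQuotient.on quotmod.

Lemma eqquotmodP (x y : V) :
  reflect (\pi_quotmod x = \pi_quotmod y) (x - y \in W).
Proof.
have -> : (x - y \in W) = (x == y %[mod quotmod]).
  exact: (Quotient.idealrBE submod_pred).
exact: eqP.
Qed.

Definition quotmod_scale (a : R) (u : quotmod) : quotmod :=
  \pi_quotmod (a *: repr u).

Lemma pi_quotmod_scale a x :
  \pi_quotmod (a *: x) = quotmod_scale a (\pi_quotmod x).
Proof.
apply/eqquotmodP; rewrite -scalerBr rpredZ//.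
by apply/eqquotmodP; rewrite reprK.
Qed.

Fact quotmod_scaleA a b u :
  quotmod_scale a (quotmod_scale b u) = quotmod_scale (a * b) u.
Proof. by rewrite -[u]reprK -(pi_quotmod_scale b) -!pi_quotmod_scale scalerA. Qed.

Fact quotmod_scale1 : left_id 1 quotmod_scale.
Proof. by move=> u; rewrite -[u]reprK -pi_quotmod_scale scale1r. Qed.

Fact quotmod_scaleDr : right_distributive quotmod_scale +%R.
Proof.
move=> a u v; rewrite -[u]reprK -[v]reprK.
by rewrite -raddfD -!pi_quotmod_scale scalerDr raddfD.
Qed.

Fact quotmod_scaleDl u : {morph quotmod_scale^~ u : a b / a + b}.
Proof.
by move=> a b; rewrite -[u]reprK -!pi_quotmod_scale scalerDl raddfD.
Qed.

HB.instance Definition _ := GRing.Zmodule_isLmodule.Build R quotmod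
  quotmod_scaleA quotmod_scale1 quotmod_scaleDr quotmod_scaleDl.

Definition to_quotmod (x : V) : quotmod := \pi_quotmod x.

Fact to_quotmod_is_linear : linear to_quotmod.
Proof.
move=> a x y; rewrite /to_quotmod raddfD; congr (_ + _).
exact: pi_quotmod_scale.
Qed.
HB.instance Definition _ :=
  GRing.isLinear.Build R V quotmod *:%R to_quotmod to_quotmod_is_linear.

End QuotientModule.

Section QuotientMap.
Variables (R : nzRingType) (V V' : lmodType R).
Variables (W : submodClosed V) (W' : submodClosed V').
Variables (f : {linear V -> V'}) (fW : forall x, x \in W -> f x \in W').

(* The hypothesis fW is what makes the choice of representative irrelevant. *)
Definition quot_map_of (_ : forall x, x \in W -> f x \in W')
  (u : quotmod W) : quotmod W' := to_quotmod W' (f (repr u)).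
Local Notation quot_map := (quot_map_of fW).

Lemma quot_mapE x : quot_map (to_quotmod W x) = to_quotmod W' (f x).
Proof.
apply/eqquotmodP; rewrite -raddfB; apply: fW.
by apply/eqquotmodP; rewrite reprK.
Qed.

Fact quot_map_is_linear : linear quot_map.
Proof.
move=> a u v; rewrite -[u]reprK -[v]reprK -!/(to_quotmod _ _).
by rewrite -linearP !quot_mapE !linearP.
Qed.
HB.instance Definition _ := GRing.isLinear.Build R (quotmod W) (quotmod W')
  *:%R quot_map quot_map_is_linear.

End QuotientMap.

Section Homology.
Variables (R : nzRingType) (A B C : lmodType R).
Variables (f : {linear A -> B}) (g : {linear B -> C}).

Definition in_ker : {pred B} := fun x => g x == 0.

Fact in_ker_submod : submod_closed in_ker.
Proof.
split=> [|a x y]; rewrite !unfold_in ?linear0// => /eqP gx /eqP gy.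
by rewrite linearP gx gy scaler0 addr0.
Qed.
HB.instance Definition _ :=
  GRing.isSubmodClosed.Build R B in_ker (GRing.submod_closed_semi in_ker_submod).

Definition ker := {x : B | x \in in_ker}.
HB.instance Definition _ := Choice.on ker.
HB.instance Definition _ := SubType.on ker.
HB.instance Definition _ := [SubChoice_isSubLmodule of ker by <:].

(* The image of f, as a submodule of ker g: the homology below is
   ker g / (im f `&` ker g), i.e. ker g / im f when g \o f = 0. *)
Definition in_im : {pred ker} := fun x => `[< exists a, f a = val x >].

Fact in_im_submod : submod_closed in_im.
Proof.
split=> [|a x y]; rewrite !unfold_in.
  by apply/asboolP; exists 0; rewrite !linear0.
move=> /asboolP[b fb] /asboolP[c fc]; apply/asboolP; exists (a *: b + c).
by rewrite !linearP fb fc.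
Qed.
HB.instance Definition _ :=
  GRing.isSubmodClosed.Build R ker in_im (GRing.submod_closed_semi in_im_submod).

Definition homology := quotmod in_im.
HB.instance Definition _ := GRing.Lmodule.on homology.

Definition homology_class (x : ker) : homology := to_quotmod in_im x.

End Homology.

Section Simplices.
Variables (X : choiceType) (U : set (set X)).

Definition small (q : nat) (s : q.+1.-tuple X) : Prop :=
  exists2 A, U A & forall i, A (tnth s i).

Definition face (q : nat) (j : 'I_q.+2) (s : q.+2.-tuple X) : q.+1.-tuple X :=
  [tuple tnth s (fintype.lift j i) | i < q.+1].

Lemma small_face q (j : 'I_q.+2) (s : q.+2.-tuple X) :
  small s -> small (face j s).
Proof. by case=> A UA sA; exists A => // i; rewrite tnth_mktuple. Qed.

Definition small_simplex (q : nat) := {s : q.+1.-tuple X | `[< small s >]}.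

Fact small_face_subproof q (j : 'I_q.+2) (s : small_simplex q.+1) :
  `[< small (face j (val s)) >].
Proof. by apply/asboolP/small_face/asboolP/(valP s). Qed.

Definition small_simplex_face q (j : 'I_q.+2) (s : small_simplex q.+1) :
  small_simplex q := Sub (face j (val s)) (small_face_subproof j s).

End Simplices.

Section FreeLift.
Variables (R : nzRingType) (T : choiceType) (M : lmodType R) (f : T -> M).

Fact fglift_is_linear : linear (fglift f : {freeg T / R} -> M).
Proof.
have fgB := lift_is_additive f.
have fg0 : fglift f 0 = 0 by rewrite -[in LHS](subrr 0) fgB subrr.
have fgN x : fglift f (- x) = - fglift f x by rewrite -[- x]add0r fgB fg0 sub0r.
have fgD x y : fglift f (x + y) = fglift f x + fglift f y.
  by rewrite -[y in LHS]opprK fgB fgN opprK.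
move=> a x y; rewrite fgD; congr (_ + _).
elim/freeg_ind_dom0: x => [|c t D _ _ IH]; first by rewrite scaler0 fg0 scaler0.
have aU : a *: << c *g t >> = << a * c *g t >> :> {freeg T / R}.
  by apply/eqP/freeg_eqP => z; rewrite coeffZ !coeffU mulrA.
by rewrite scalerDr !fgD IH scalerDr aU !liftU scalerA.
Qed.
HB.instance Definition _ := GRing.isLinear.Build R {freeg T / R} M *:%R
  (fglift f) fglift_is_linear.

End FreeLift.

Section Complexes.
Variables (K : fieldType) (X : choiceType) (U : set (set X)).

Definition chain (q : nat) := {freeg (small_simplex U q) / K}.
HB.instance Definition _ q := GRing.Lmodule.on (chain q).

Definition boundary_simplex q (s : small_simplex U q.+1) : chain q :=
  \sum_(j < q.+2) (-1) ^+ j *: << small_simplex_face j s >>.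

Definition boundary q : {linear chain q.+1 -> chain q} :=
  fglift (@boundary_simplex q).

(* Chains in degree -1 are zero.  To avoid a dependent source or target, the map
   leaving degree 0 is encoded as the zero endomorphism of the degree 0 part, and
   dually for cochains; the kernel, resp. image, is the same. *)
Definition boundary_from q : {linear chain q -> chain q.-1} :=
  match q with 0 => \0 | q'.+1 => boundary q' end.

Definition homology_small (q : nat) :=
  homology (boundary q) (boundary_from q).
HB.instance Definition _ q := GRing.Lmodule.on (homology_small q).

Definition cochain (q : nat) := q.+1.-tuple X -> K^o.
HB.instance Definition _ q := GRing.Lmodule.on (cochain q).

Definition coboundary q (xi : cochain q) : cochain q.+1 :=
  fun s => \sum_(j < q.+2) (-1) ^+ j * xi (face j s).

Fact coboundary_is_linear q : linear (@coboundary q).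
Proof.
move=> a x y; apply/funext => s; rewrite /coboundary !fctE scaler_sumr -big_split.
by apply: eq_bigr => j _ /=; rewrite mulrDr; congr (_ + _); rewrite mulrCA.
Qed.
HB.instance Definition _ q := GRing.isLinear.Build K (cochain q) (cochain q.+1)
  *:%R (@coboundary q) (@coboundary_is_linear q).

Definition locally_zero q : {pred cochain q} :=
  fun xi => `[< forall s : q.+1.-tuple X, small U s -> xi s = 0 >].

Fact locally_zero_submod q : submod_closed (@locally_zero q).
Proof.
split=> [|a x y]; rewrite !unfold_in; first exact/asboolP.
move=> /asboolP x0 /asboolP y0; apply/asboolP => s Us.
by rewrite !fctE x0// y0// scaler0 addr0.
Qed.
HB.instance Definition _ q := GRing.isSubmodClosed.Build K (cochain q)
  (@locally_zero q) (GRing.submod_closed_semi (@locally_zero_submod q)).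

Lemma coboundary_locally_zero q (xi : cochain q) :
  xi \in @locally_zero q -> coboundary xi \in @locally_zero q.+1.
Proof.
rewrite !unfold_in => /asboolP xi0; apply/asboolP => s Us.
by apply: big1 => j _; rewrite xi0 ?mulr0//; exact: small_face.
Qed.

Definition local_cochain (q : nat) := quotmod (@locally_zero q).
HB.instance Definition _ q := GRing.Lmodule.on (local_cochain q).

Definition local_coboundary q : {linear local_cochain q -> local_cochain q.+1} :=
  quot_map_of (@coboundary_locally_zero q).

Definition local_coboundary_to q :
    {linear local_cochain q.-1 -> local_cochain q} :=
  match q with 0 => \0 | q'.+1 => local_coboundary q' end.

Definition cohomology_local (q : nat) :=
  homology (local_coboundary_to q) (local_coboundary q).
HB.instance Definition _ q := GRing.Lmodule.on (cohomology_local q).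

(* xi(c) = \sum_i k_i xi(sigma_i) for c = \sum_i k_i sigma_i. *)
Definition eval q (xi : cochain q) (c : chain q) : K :=
  fglift (fun s : small_simplex U q => xi (val s)) c.

(* The representatives used here are arbitrary, by integralE below. *)
Definition integral q (z : cohomology_local q) (gamma : homology_small q) : K :=
  eval (repr (val (repr z))) (val (repr gamma)).

Lemma chain_ind q (P : chain q -> Prop) :
  P 0 -> (forall a s c, P c -> P (a *: << s >> + c)) -> forall c, P c.
Proof.
move=> P0 PD; elim/freeg_ind_dom0 => // a s c _ _ Pc.
have <- : a *: << s >> = << a *g s >> :> chain q.
  by apply/eqP/freeg_eqP => t; rewrite coeffZ !coeffU mul1r.
exact: PD.
Qed.

Lemma eval_is_linear q (xi : cochain q) : scalar (eval xi).
Proof.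
move=> a c d.
exact: (fglift_is_linear (fun s : small_simplex U q => xi (val s)) a c d).
Qed.
HB.instance Definition _ q (xi : cochain q) :=
  GRing.isLinear.Build K (chain q) K *%R (eval xi) (eval_is_linear xi).

Lemma evalPU q (xi : cochain q) a s c :
  eval xi (a *: << s >> + c) = a * xi (val s) + eval xi c.
Proof. by rewrite eval_is_linear {1}/eval liftU scale1r. Qed.

Lemma evalBl q (xi eta : cochain q) (c : chain q) :
  eval (xi - eta) c = eval xi c - eval eta c.
Proof.
elim/chain_ind: c => [|a s c IH]; first by rewrite !linear0 subr0.
by rewrite !evalPU IH mulrBr opprD addrACA.
Qed.

Lemma eval_locally_zero q (xi : cochain q) (c : chain q) :
  xi \in @locally_zero q -> eval xi c = 0.
Proof.
rewrite unfold_in => /asboolP xi0.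
elim/chain_ind: c => [|a s c IH]; first by rewrite linear0.
by rewrite evalPU IH xi0 ?mulr0 ?addr0//; exact/asboolP/(valP s).
Qed.

Lemma eval_coboundary q (xi : cochain q) (c : chain q.+1) :
  eval (coboundary xi) c = eval xi (boundary q c).
Proof.
elim/chain_ind: c => [|a s c IH]; first by rewrite !linear0.
rewrite evalPU IH (linearP (boundary q)) eval_is_linear; congr (_ * _ + _).
rewrite /boundary/= liftU scale1r /boundary_simplex linear_sum.
apply: eq_bigr => j _ /=; rewrite -[X in eval _ X]addr0 evalPU linear0 addr0.
by rewrite /small_simplex_face SubK.
Qed.

Lemma to_quotmod_eq0 q (xi : cochain q) :
  to_quotmod (@locally_zero q) xi = 0 -> xi \in @locally_zero q.
Proof.
move=> xi0; rewrite -[xi]subr0; apply/eqquotmodP.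
by rewrite -!/(to_quotmod _ _) xi0 linear0.
Qed.

Lemma eval_boundary q (z : ker (local_coboundary q)) (xi : cochain q) c :
  val z = to_quotmod _ xi -> eval xi (boundary q c) = 0.
Proof.
move=> zxi; rewrite -eval_coboundary; apply/eval_locally_zero/to_quotmod_eq0.
have /eqP := valP z; rewrite zxi => <-.
by rewrite [RHS]quot_mapE.
Qed.

Lemma eval_coboundary_to q (c : ker (boundary_from q)) (xi : cochain q) u :
  local_coboundary_to q u = to_quotmod _ xi -> eval xi (val c) = 0.
Proof.
case: q c xi u => [|q] c xi u /=.
  by move=> /esym xi0; apply/eval_locally_zero/to_quotmod_eq0.
rewrite -[u]reprK -/(to_quotmod _ _) quot_mapE => /esym/eqquotmodP xiu.
have /(eval_locally_zero (val c)) := xiu.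
rewrite evalBl eval_coboundary => /eqP; rewrite subr_eq0 => /eqP ->.
by have /eqP /= -> := valP c; rewrite linear0.
Qed.

Lemma eval_cycle q (z z' : ker (local_coboundary q))
    (c c' : ker (boundary_from q)) (xi xi' : cochain q) :
  val z = to_quotmod _ xi -> val z' = to_quotmod _ xi' ->
  homology_class (local_coboundary_to q) z = homology_class _ z' ->
  homology_class (boundary q) c = homology_class _ c' ->
  eval xi (val c) = eval xi' (val c').
Proof.
move=> zxi zxi' /eqquotmodP + /eqquotmodP; rewrite !unfold_in.
move=> /asboolP[u uzz'] /asboolP[b bcc'].
apply/eqP; rewrite -subr_eq0 -(subrKA (eval xi' (val c))) -evalBl -linearB.
have <- : boundary q b = val c - val c' by rewrite bcc' linearB.
rewrite [X in _ + X](eval_boundary b zxi') addr0.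
apply/eqP/(eval_coboundary_to _ (u := u)).
by rewrite uzz' linearB/= zxi zxi' linearB.
Qed.

Lemma integralE q (z : ker (local_coboundary q)) (c : ker (boundary_from q))
    (xi : cochain q) :
  val z = to_quotmod _ xi ->
  integral (homology_class _ z) (homology_class _ c) = eval xi (val c).
Proof.
move=> zxi; apply: (eval_cycle _ zxi).
- by rewrite [LHS]/= -[LHS]reprK.
- exact: reprK.
- exact: reprK.
Qed.

End Complexes.

(* Main.v *)
Require Import Defs.
From mathcomp Require Import all_boot all_order all_algebra.
From mathcomp Require Import freeg.
From mathcomp Require Import all_classical topology.

(** The integration pairing separates homology classes because cochains modulo
    locally zero ones are exactly the linear dual of the small chains: such a
    class of cochains is nothing but a choice of one scalar for each small
    simplex, that is, for each element of a basis ([eval_functional_cochain]).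
    Under this identification the coboundary is the transpose of the boundary,
    so the cocycles are the functionals that vanish on boundaries.

    If a small cycle is not a boundary, linear algebra over a field provides a
    functional that vanishes on all boundaries but not on this cycle
    ([separating_functional]).  It is a cocycle, and the integral of its class
    over the class of the cycle is not zero.  The space of chains has infinite
    dimension in general, so the functional comes from Zorn's lemma: a maximal
    subspace that avoids a given vector is a hyperplane, and the functional is
    the projection along it. *)

Set Implicit Arguments.
Unset Strict Implicit.
Unset Printing Implicit Defensive.

Import GRing.Theory.
Local Open Scope classical_set_scope.
Local Open Scope ring_scope.

Section Separation.
Variables (K : fieldType) (V : lmodType K).

Definition subspace (W : set V) :=
  W 0 /\ forall (a : K) x y, W x -> W y -> W (a *: x + y).

Lemma subspaceZ W a x : subspace W -> W x -> W (a *: x).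
Proof. by case=> W0 WP Wx; rewrite -[_ *: _]addr0; exact: WP. Qed.

(** Zorn's lemma needs the union of the empty chain to be admissible, hence the
    order is on sets [A] such that [A `|` W], rather than [A], is a subspace
    that avoids [v]. *)
Lemma maximal_avoiding_subspace (W : set V) v : subspace W -> ~ W v ->
  exists M : set V, [/\ subspace M, W `<=` M, ~ M v &
    forall N, subspace N -> M `<=` N -> ~ N v -> N `<=` M].
Proof.
move=> Wsub Wv.
pose P (A : set V) := subspace (A `|` W) /\ ~ (A `|` W) v.
have [F FP Ftot|A [[Asub Av] Amax]] := @Zorn_bigcup V P.
  split; last by move=> [[A FA Av]|//]; have [_ []] := FP _ FA; left.
  split=> [|a x y]; first by right; exact: Wsub.1.
  have inF A (FA : F A) z : (A `|` W) z -> (\bigcup_(B in F) B `|` W) z.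
    by move=> [Az|Wz]; [left; exists A|right].
  move=> [[A FA Ax]|Wx] [[B FB By]|Wy]; last first.
  - by right; exact: Wsub.2.
  - by apply: (inF B FB); apply: (FP _ FB).1.2; [right|left].
  - by apply: (inF A FA); apply: (FP _ FA).1.2; [left|right].
  - have [AB|BA] := Ftot _ _ FA FB.
      by apply: (inF B FB); apply: (FP _ FB).1.2; left => //; exact: AB.
    by apply: (inF A FA); apply: (FP _ FA).1.2; left => //; exact: BA.
exists (A `|` W); split=> // N Nsub AN Nv x Nx.
have NW : N `|` W = N.
  by apply/setUidPl => y Wy; apply: AN; right.
apply: contrapT => Ax; apply: (Amax N); last by rewrite /P NW.
split=> [|NA]; first by move=> y Ay; apply: AN; left.
by apply: Ax; left; exact: NA.
Qed.

(** If the line through [v] and [M] together missed some [x], the sum of [M]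
    and the line through [x] would still avoid [v]. *)
Lemma maximal_avoiding_hyperplane (M : set V) v : subspace M -> ~ M v ->
  (forall N, subspace N -> M `<=` N -> ~ N v -> N `<=` M) ->
  forall x, exists a : K, M (x - a *: v).
Proof.
move=> Msub Mv Mmax x; have [Mx|Mx] := pselect (M x).
  by exists 0; rewrite scale0r subr0.
pose N : set V := [set y | exists b : K, M (y - b *: x)].
have Nx : N x by exists 1; rewrite scale1r subrr; exact: Msub.1.
have MN : M `<=` N by move=> y My; exists 0; rewrite scale0r subr0.
have Nsub : subspace N.
  split=> [|a y z [b Mb] [c Mc]]; first exact/MN/Msub.1.
  exists (a * b + c); suff -> : a *: y + z - (a * b + c) *: x =
      a *: (y - b *: x) + (z - c *: x) by exact: Msub.2.
  by rewrite scalerDl -scalerA scalerBr opprD addrACA.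
have [[b Mb]|Nv] := pselect (N v); last by case: Mx; exact: (Mmax N).
have b0 : b != 0.
  by apply/eqP => b0; apply: Mv; move: Mb; rewrite b0 scale0r subr0.
exists b^-1; suff -> : x - b^-1 *: v = (- b^-1) *: (v - b *: x).
  exact: subspaceZ.
by rewrite scalerBr scalerA mulNr mulVf// scaleN1r scaleNr opprK addrC.
Qed.

(** The functional sends [x] to its coefficient along [v] modulo the hyperplane
    [M]; since [v] is not in [M] this coefficient is unique, which makes the
    functional linear. *)
Lemma separating_functional (W : set V) v : subspace W -> ~ W v ->
  exists phi : V -> K,
    [/\ scalar phi, forall w, W w -> phi w = 0 & phi v = 1].
Proof.
move=> Wsub Wv.
have [M [Msub WM Mv Mmax]] := maximal_avoiding_subspace Wsub Wv.
have /choice[phi Mphi] := maximal_avoiding_hyperplane Msub Mv Mmax.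
have phi_uniq a x : M (x - a *: v) -> phi x = a.
  move=> Ma; apply/eqP/negP => /negP; rewrite eq_sym -subr_eq0 => d0; apply: Mv.
  rewrite -[v]scale1r -(mulVf d0) -scalerA; apply: subspaceZ => //.
  suff -> : (a - phi x) *: v = (-1) *: (x - a *: v) + (x - phi x *: v).
    exact: Msub.2.
  by rewrite scaleN1r opprB scalerBl [RHS]addrA subrK.
exists phi; split=> [a x y|w Ww|]; apply: phi_uniq.
- suff -> : a *: x + y - (a * phi x + phi y) *: v =
      a *: (x - phi x *: v) + (y - phi y *: v) by exact: Msub.2.
  by rewrite scalerDl -scalerA scalerBr opprD addrACA.
- by rewrite scale0r subr0; exact: WM.
- by rewrite scale1r subrr; exact: Msub.1.
Qed.

End Separation.

Section FunctionalCochain.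
Variables (K : fieldType) (X : choiceType) (U : set (set X)) (q : nat).

(** Extension by 0 to the simplices that are not small selects one
    representative among cochains that differ by locally zero ones. *)
Definition functional_cochain (phi : chain K U q -> K) : cochain K X q :=
  fun s => if insub s is Some t then phi << (t : small_simplex U q) >> else 0.

(** Both sides are linear and agree on the basis of small simplices. *)
Lemma eval_functional_cochain (phi : chain K U q -> K) : scalar phi ->
  forall c, Defs.eval (functional_cochain phi) c = phi c.
Proof.
move=> phiP; elim/chain_ind => [|a s c IH].
  rewrite linear0; have := phiP (-1) 0 0.
  by rewrite scaler0 addr0 mulN1r addNr.
by rewrite evalPU IH phiP /functional_cochain valK.
Qed.

(** The coboundary is the transpose of the boundary, so a functional that
    vanishes on boundaries has a coboundary that vanishes on small simplices. *)
Lemma functional_cochain_cocycle (phi : chain K U q -> K) : scalar phi ->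
    (forall c, phi (boundary K U q c) = 0) ->
  to_quotmod (@locally_zero K X U q) (functional_cochain phi)
    \in in_ker (local_coboundary K U q).
Proof.
move=> phiP phi0; rewrite unfold_in; apply/eqP.
rewrite [LHS]quot_mapE -(linear0 (to_quotmod _)); apply/eqquotmodP.
rewrite subr0 unfold_in; apply/asboolP => s Us.
pose t : small_simplex U q.+1 := Sub s (introT (asboolP _) Us).
have -> : s = val t by rewrite SubK.
have := evalPU (coboundary (functional_cochain phi)) 1 t 0.
rewrite mul1r linear0 !addr0 => E; apply: (etrans (esym E)).
by rewrite eval_coboundary eval_functional_cochain.
Qed.

End FunctionalCochain.

Theorem proposition20 (K : fieldType) (X : topologicalType)
    (U : set (set X)) (Uopen : forall A, U A -> open A)
    (Ucover : cover U id = [set: X]) (q : nat)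
    (gamma : homology_small K U q) :
  (forall z : cohomology_local K U q, integral z gamma = 0) ->
  gamma = 0.
Proof.
move=> gamma0; pose c := repr gamma.
have gammaE : gamma = homology_class (boundary K U q) c by rewrite -[LHS]reprK.
suff [b bc] : exists b, boundary K U q b = val c.
  rewrite gammaE; transitivity (homology_class (boundary K U q)
    (0 : ker (boundary_from K U q))); last by rewrite /homology_class linear0.
  by apply/eqquotmodP; rewrite subr0 unfold_in; apply/asboolP; exists b.
apply: contrapT => cB.
have Bsub : subspace (range (boundary K U q)).
  split=> [|a _ _ [b _ <-] [d _ <-]]; first by exists 0; rewrite ?linear0.
  by exists (a *: b + d); rewrite ?linearP.
have [|phi [phiP phiB phic]] := separating_functional Bsub (v := val c).
  by move=> [b _ bc]; apply: cB; exists b.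
have phi0 b : phi (boundary K U q b) = 0 by apply: phiB; exists b.
pose z : ker (local_coboundary K U q) :=
  exist (fun u => u \in in_ker _) _ (functional_cochain_cocycle phiP phi0).
have := gamma0 (homology_class _ z).
rewrite gammaE (integralE _ (xi := functional_cochain phi)) //.
by rewrite eval_functional_cochain// phic => /eqP; rewrite oner_eq0.
Qed.
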